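(* Let $n,m\in\mathbb{N}$, and let $X\subset\mathbb{R}^n$, functions $f_1,\dots,f_m$ and a constant $C>0$ satisfy Assumption A of the context; put $f=\sum_{i=1}^m f_i$ and $f^*=\inf_{x\in X} f(x)\in\mathbb{R}\cup\{-\infty\}$. Let $\{x_k\}_{k\ge 0}$ be generated by the incremental cutting-plane algorithm of the context with memory size $W$, step sizes $\{t_k\}$ and evaluation schedule $\{I_k\}$. Assume that every component is evaluated at least once in every $W$ consecutive iterations, i.e. $i\in\bigcup_{l=0}^{W-1} I_{k+l}$ for all $k\ge 0$ and all $i\in\{1,\dots,m\}$, and that $$t_k>0\ (\forall k),\quad t_k\ge t_{k+1}\ (\forall k),\quad \lim_{k\to\infty}t_k=0,\quad \sum_{k=0}^\infty t_k=\infty .$$ Then $$\liminf_{k\to\infty} f(x_k)=f^* .$$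
   Context: Assumption A: (1) $X\subset\mathbb{R}^n$ is nonempty, closed and convex. (2) For $i=1,\dots,m$, $f_i:\mathbb{R}^n\to\mathbb{R}$ is convex, and is finite and subdifferentiable over $X$. (3) $C>0$ is such that $\|g\|\le C$ for all $i\in\{1,\dots,m\}$, all $x\in X$ and all $g\in\partial f_i(x)$, where $\partial f_i(x)$ is the subdifferential of $f_i$ at $x$ and $\|\cdot\|$ is the Euclidean norm. Incremental cutting-plane algorithm: Select $x_0\in X$, a memory size $W\in\mathbb{N}$, $W\ge1$, step sizes $t_k>0$ ($k\ge 0$) and an evaluation schedule $I_k\subset\{1,\dots,m\}$ ($k\ge 0$). For $k=0,1,2,\dots$: (a) for each $i\in I_k$ evaluate $f_i(x_k)$ and some subgradient $g_i(x_k)\in\partial f_i(x_k)$ (an arbitrary choice); (b) let $x_{k+1}=\arg\min_{x\in X}\breve f_k(x)$ (the unique minimizer), where $$\breve f_k(x)=\sum_{i=1}^m \hat f_{k,i}(x)+\frac{1}{2t_k}\|x-x_k\|^2,$$ $$\hat f_{k,i}(x)=\max_{l\in B_{k,i}}\left\{ f_i(x_{k-l})+g_i(x_{k-l})^T(x-x_{k-l})\right\}\ \text{ if } B_{k,i}\neq\emptyset,\qquad \hat f_{k,i}(x)=0\ \text{ otherwise},$$ $$B_{k,i}=\{l\in\mathbb{Z}\mid 0\le l\le\min\{k,W-1\},\ i\in I_{k-l}\}.$$ *)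

(* Defs.v *)
From HB Require Import structures.
From mathcomp Require Import all_boot all_order all_algebra.
From mathcomp Require Import all_classical all_reals all_analysis.

Set Implicit Arguments.
Unset Strict Implicit.
Unset Printing Implicit Defensive.

Import Order.TTheory GRing.Theory Num.Theory.
Import numFieldNormedType.Exports.

Local Open Scope classical_set_scope.
Local Open Scope ring_scope.

Definition dotp (R : realType) (n : nat) (u v : 'rV[R]_n) : R :=
  \sum_(j < n) u 0 j * v 0 j.

(* The library norm `|_| on 'rV[R]_n is the sup norm. *)
Definition enorm (R : realType) (n : nat) (u : 'rV[R]_n) : R :=
  Num.sqrt (dotp u u).

Definition subdiff (R : realType) (n : nat) (f : 'rV[R]_n -> R)
    (x : 'rV[R]_n) : set 'rV[R]_n :=
  [set g | forall y, f x + dotp g (y - x) <= f y].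

Definition argmin (T : Type) (R : realType) (X : set T) (F : T -> R) : set T :=
  [set z | X z /\ forall y, X y -> F z <= F y].

Definition objective (R : realType) (n m : nat) (f : 'I_m -> 'rV[R]_n -> R)
    (x : 'rV[R]_n) : R :=
  \sum_(i < m) f i x.

(* Finiteness of each f i over X is built into the codomain R. *)
Record assumptionA (R : realType) (n m : nat) (X : set 'rV[R]_n)
    (f : 'I_m -> 'rV[R]_n -> R) (C : R) : Prop := AssumptionA {
  domain_nonempty : X !=set0 ;
  domain_closed : closed X ;
  domain_convex : convex_set X ;
  component_convex : forall i, convex_function setT (f i) ;
  component_subdifferentiable : forall i x, X x -> subdiff (f i) x !=set0 ;
  subgradient_bound_gt0 : 0 < C ;
  subgradient_bound : forall i x g, X x -> subdiff (f i) x g -> enorm g <= C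
}.

Section CuttingPlane.
Variables (R : realType) (n m : nat).
Variables (X : set 'rV[R]_n) (f : 'I_m -> 'rV[R]_n -> R).
Variables (W : nat) (t : nat -> R) (I : nat -> {set 'I_m}).
(* x k is the k-th iterate; g k i is the subgradient of f i chosen at
   iteration k, which is only relevant when i \in I k. *)
Variables (x : nat -> 'rV[R]_n) (g : nat -> 'I_m -> 'rV[R]_n).

Definition memory (k : nat) (i : 'I_m) : seq nat :=
  [seq l <- iota 0 (minn k W.-1).+1 | i \in I (k - l)%N].

Definition linearization (k : nat) (i : 'I_m) (y : 'rV[R]_n) : R :=
  f i (x k) + dotp (g k i) (y - x k).

(* The default value of the big maximum is one of its terms, so that it does
   not affect the result. *)
Definition component_model (k : nat) (i : 'I_m) (y : 'rV[R]_n) : R :=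
  if memory k i is l0 :: _ then
    \big[Num.max/linearization (k - l0)%N i y]_(l <- memory k i)
      linearization (k - l)%N i y
  else 0.

Definition model (k : nat) (y : 'rV[R]_n) : R :=
  \sum_(i < m) component_model k i y
  + (2 * t k)^-1 * enorm (y - x k) ^+ 2.

Record incremental_cutting_plane : Prop := IncrementalCuttingPlane {
  memory_size_gt0 : (1 <= W)%N ;
  step_size_gt0 : forall k, 0 < t k ;
  initial_point : X (x 0%N) ;
  subgradient_choice : forall k i, i \in I k -> subdiff (f i) (x k) (g k i) ;
  next_iterate : forall k, argmin X (model k) (x k.+1)
}.

End CuttingPlane.

(* Main.v *)
Require Import Defs.
From mathcomp Require Import all_boot all_order all_algebra.
From mathcomp Require Import all_classical all_reals all_analysis.
From mathcomp Require Import ring lra zify.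

Import Order.TTheory GRing.Theory Num.Theory.
Import numFieldNormedType.Exports.

Local Open Scope classical_set_scope.
Local Open Scope ring_scope.

(* The cut models are convex and [m C]-Lipschitz, so optimality of [x k.+1]
   against [x k] gives steps of length at most [m C t_k]. Since every component
   has a cut of age less than [W], the sum of the cut models at [x k.+1] is
   within [e_k = O(max of the last W steps)] of [f (x k)], and it is below [f]
   everywhere; the three-point inequality of the proximal step then reads
     [|y - x k.+1|^2 <= |y - x k|^2 + 2 t_k (f y - f (x k) + e_k)], [e_k -> 0].
   If [f (x k)] stayed above [f y] by a fixed gap, summing would contradict
   [\sum t_k = oo]. *)

(** * Euclidean inner product and norm *)

Section EuclideanNorm.
Context {R : realType} {n : nat}.
Implicit Types (a : R) (u v w : 'rV[R]_n).

Lemma dotpC u v : dotp u v = dotp v u.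
Proof. by apply: eq_bigr => j _; rewrite mulrC. Qed.

Lemma dotpDr u v w : dotp u (v + w) = dotp u v + dotp u w.
Proof. by rewrite -big_split; apply: eq_bigr => j _; rewrite mxE mulrDr. Qed.

Lemma dotpZr a u v : dotp u (a *: v) = a * dotp u v.
Proof. by rewrite mulr_sumr; apply: eq_bigr => j _; rewrite mxE mulrCA. Qed.

Lemma dotpDl u v w : dotp (u + v) w = dotp u w + dotp v w.
Proof. by rewrite dotpC dotpDr !(dotpC w). Qed.

Lemma dotpZl a u v : dotp (a *: u) v = a * dotp u v.
Proof. by rewrite dotpC dotpZr dotpC. Qed.

Lemma dotpNr u v : dotp u (- v) = - dotp u v.
Proof. by rewrite -scaleN1r dotpZr mulN1r. Qed.

Lemma dotp0 u : dotp u 0 = 0.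
Proof. by apply: big1 => j _; rewrite mxE mulr0. Qed.

Lemma dotpp_ge0 u : 0 <= dotp u u.
Proof. by apply: sumr_ge0 => j _; rewrite -expr2 sqr_ge0. Qed.

Lemma enorm_ge0 u : 0 <= enorm u.
Proof. exact: sqrtr_ge0. Qed.

Lemma sqr_enorm u : enorm u ^+ 2 = dotp u u.
Proof. by rewrite sqr_sqrtr ?dotpp_ge0. Qed.

Lemma enormN u : enorm (- u) = enorm u.
Proof. by rewrite /enorm dotpNr dotpC dotpNr opprK. Qed.

Lemma sqr_enormD u v :
  enorm (u + v) ^+ 2 = enorm u ^+ 2 + 2 * dotp u v + enorm v ^+ 2.
Proof. by rewrite !sqr_enorm !(dotpDl, dotpDr) (dotpC v u); ring. Qed.

Lemma sqr_enormZ a u : enorm (a *: u) ^+ 2 = a ^+ 2 * enorm u ^+ 2.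
Proof. by rewrite !sqr_enorm dotpZl dotpZr mulrA. Qed.

Lemma enorm0_eq0 u : enorm u = 0 -> u = 0.
Proof.
move=> u0; have /eqP : dotp u u = 0 by rewrite -sqr_enorm u0 expr0n.
rewrite psumr_eq0 => [/allP uu0|j _]; last by rewrite -expr2 sqr_ge0.
apply/rowP => j; rewrite mxE.
by have := uu0 j (mem_index_enum _); rewrite -expr2 sqrf_eq0 => /eqP.
Qed.

(** Cauchy-Schwarz: the square of [|v| u - |u| v] is [2 |u| |v| (|u| |v| - <u, v>)], and the
    positive factor cancels once zero norms are set aside. *)
Lemma dotp_le_enorm u v : dotp u v <= enorm u * enorm v.
Proof.
have [u0|u0] := eqVneq (enorm u) 0.
  by rewrite u0 mul0r (enorm0_eq0 _ u0) dotpC dotp0.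
have [v0|v0] := eqVneq (enorm v) 0.
  by rewrite v0 mulr0 (enorm0_eq0 _ v0) dotp0.
have uv_gt0 : 0 < enorm u * enorm v.
  by rewrite mulr_gt0 // lt_neqAle enorm_ge0 eq_sym ?u0 ?v0.
have := dotpp_ge0 (enorm v *: u + (- enorm u) *: v).
rewrite !(dotpDl, dotpDr, dotpZl, dotpZr) (dotpC v u) -!sqr_enorm.
rewrite (_ : _ + _ = 2 * (enorm u * enorm v) * (enorm u * enorm v - dotp u v)).
  by rewrite pmulr_rge0 ?subr_ge0 // mulr_gt0.
by ring.
Qed.

Lemma enormD u v : enorm (u + v) <= enorm u + enorm v.
Proof.
have uv_ge0 : 0 <= enorm u + enorm v by rewrite addr_ge0 ?enorm_ge0.
rewrite -(ler_pXn2r (_ : 0 < 2)%N) ?nnegrE ?enorm_ge0 //.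
by rewrite sqr_enormD; have := dotp_le_enorm u v; lra.
Qed.

Lemma enormB u v : enorm (u - v) = enorm (v - u).
Proof. by rewrite -opprB enormN. Qed.

Lemma le_enorm_dotp u v : - (enorm u * enorm v) <= dotp u v.
Proof. by have := dotp_le_enorm u (- v); rewrite dotpNr enormN lerNl. Qed.

End EuclideanNorm.

(** * Three-point inequality of a proximal step *)

Section Prox.
Context {R : realType} {n : nat}.
Implicit Types (X : set 'rV[R]_n) (F : 'rV[R]_n -> R) (a : R).

(* Comparing [z] with the points of the segment from [z] to [y] gives
   [0 <= F y - F z + 2 a <z - c, y - z> + s a |y - z|^2] for all [s] in ]0, 1];
   then let [s] tend to 0. *)
Lemma prox_three_points X F a (c y z : 'rV[R]_n) :
  convex_set X -> convex_function setT F -> 0 <= a ->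
  argmin X (fun p => F p + a * enorm (p - c) ^+ 2) z -> X y ->
  F z + a * enorm (z - c) ^+ 2 + a * enorm (y - z) ^+ 2
    <= F y + a * enorm (y - c) ^+ 2.
Proof.
move=> Xconv Fconv a_ge0 [Xz zmin] Xy.
have -> : y - c = (z - c) + (y - z) by rewrite [RHS]addrC subrKA.
set d := z - c; set w := y - z.
rewrite (sqr_enormD d w).
set A := F y - F z + 2 * a * dotp d w.
set B := a * enorm w ^+ 2.
have B_ge0 : 0 <= B by rewrite mulr_ge0 // sqr_ge0.
suff : 0 <= A by rewrite /A /B; lra.
have segment s : 0 < s -> s <= 1 -> 0 <= A + s * B.
  move=> s_gt0 s_le1; pose s01 : {i01 R} := Itv01 (ltW s_gt0) s_le1.
  have Xp : X (conv s01 (y : convex_lmodType _) (z : convex_lmodType _)).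
    by apply/set_mem/Xconv; exact: mem_set.
  have pE : conv s01 (y : convex_lmodType _) (z : convex_lmodType _)
      = z + s *: w :> 'rV[R]_n.
    rewrite /conv /= /unstable.onem scalerBl scale1r /w scalerBr.
    by rewrite addrCA.
  have := zmin _ Xp.
  have := Fconv s01 y z (in_setT _) (in_setT _).
  rewrite pE convRE /= /unstable.onem.
  have -> : z + s *: w - c = d + s *: w by rewrite addrAC.
  rewrite (sqr_enormD d) dotpZr sqr_enormZ.
  move=> Fp zp; rewrite -(pmulr_rge0 _ s_gt0) /A /B /d; nra.
rewrite leNgt; apply/negP => A_lt0.
have BA_gt0 : 0 < B - A by lra.
(* One explicit [s] replaces the limit: it lies in ]0, 1] because [A < 0 <= B], and it makes
   [A + s B] equal to [- A^2 / (B - A) < 0]. *)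
have s_gt0 : 0 < - A / (B - A) by rewrite divr_gt0 // oppr_gt0.
have s_le1 : - A / (B - A) <= 1 by rewrite ler_pdivrMr //; lra.
have := segment _ s_gt0 s_le1.
have -> : A + - A / (B - A) * B = - (A ^+ 2 / (B - A)).
  by field; rewrite gt_eqF.
rewrite oppr_ge0 leNgt => /negP; apply.
by rewrite divr_gt0 // exprn_even_gt0 //= lt_eqF.
Qed.

End Prox.

(** * Cut models: convexity, Lipschitz bound, comparison with the components *)

Section CutModel.
Context {R : realType} {n m : nat}.
Variables (f : 'I_m -> 'rV[R]_n -> R) (W : nat) (I : nat -> {set 'I_m}).
Variables (x : nat -> 'rV[R]_n) (g : nat -> 'I_m -> 'rV[R]_n).
Implicit Types (k l : nat) (i : 'I_m) (y z : 'rV[R]_n).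

Local Notation lin := (linearization f x g).
Local Notation mem := (memory W I).
Local Notation cut := (component_model f W I x g).

Lemma memoryP k i l :
  reflect [/\ (l <= k)%N, (l <= W.-1)%N & i \in I (k - l)%N] (l \in mem k i).
Proof.
rewrite mem_filter mem_iota /= add0n ltnS leq_min.
by apply: (iffP and3P) => -[].
Qed.

Lemma component_model_nil k i y : mem k i = [::] -> cut k i y = 0.
Proof. by rewrite /component_model => ->. Qed.

Lemma component_model_attained k i y : mem k i != [::] ->
  exists2 l, l \in mem k i & cut k i y = lin (k - l)%N i y.
Proof.
rewrite /component_model; case: (mem k i) => [//|l0 s] _.
rewrite big_seq; apply: (big_ind (fun v => exists2 l, l \in l0 :: s &
    v = lin (k - l)%N i y)).
- by exists l0 => //; exact: mem_head.
- by move=> u v hu hv; case: (leP u v).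
- by move=> l ls; exists l.
Qed.

Lemma linearization_le_component_model k i y l :
  l \in mem k i -> lin (k - l)%N i y <= cut k i y.
Proof.
rewrite /component_model; case: (mem k i) => [//|l0 s] ls.
exact: (le_bigmax_seq _ l).
Qed.

Lemma linearization_diff k i y z :
  lin k i y = lin k i z + dotp (g k i) (y - z).
Proof. by rewrite /linearization -addrA -dotpDr [_ - _ + (_ - _)]addrC subrKA. Qed.

(** The cut active at the convex combination is affine, and at both end points it lies below the
    maximum. *)
Lemma component_model_convex k i : convex_function setT (cut k i).
Proof.
move=> s y z _ _; have [mem0|memN0] := eqVneq (mem k i) [::].
  by rewrite !component_model_nil // convRE !mulr0 addr0.
have [l lmem ->] := component_model_attained _ _ (conv s y z) memN0.
have linE : lin (k - l)%N i (conv s y z)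
    = s%:num * lin (k - l)%N i y + (1 - s%:num) * lin (k - l)%N i z.
  rewrite (linearization_diff _ _ (conv s y z) z) (linearization_diff _ _ y z).
  have -> : conv s y z - z = s%:num *: (y - z) :> 'rV[R]_n.
    rewrite /conv /= /unstable.onem scalerBl scale1r scalerBr -addrA.
    by congr (_ + _); rewrite addrAC subrr add0r.
  by rewrite dotpZr /unstable.onem; ring.
rewrite linE convRE; apply: lerD; apply: ler_wpM2l.
- exact: ge0.
- exact: linearization_le_component_model.
- by rewrite subr_ge0 le1.
- exact: linearization_le_component_model.
Qed.

Lemma model_sum_convex k :
  convex_function setT (fun y => \sum_(i < m) cut k i y).
Proof.
move=> s y z _ _; rewrite convRE !mulr_sumr -big_split /=.
apply: ler_sum => i _.
by have := component_model_convex k i s y z (in_setT _) (in_setT _).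
Qed.

Section SubgradientCuts.
Hypothesis g_subdiff :
  forall k i, i \in I k -> subdiff (f i) (x k) (g k i).

(** The active cut is a subgradient minorant. With an empty memory the model is [0], which may
    exceed [f i y]. *)
Lemma component_model_le k i y : mem k i != [::] -> cut k i y <= f i y.
Proof.
move=> memN0; have [l /memoryP[_ _ il] ->] := component_model_attained _ _ y memN0.
exact: g_subdiff.
Qed.

Variable C : R.
Hypothesis C_ge0 : 0 <= C.
Hypothesis g_bound : forall k i, i \in I k -> enorm (g k i) <= C.

(** The cut active at [y] has slope at most [C] and minorizes the model at [z]. *)
Lemma component_model_lipschitz k i y z :
  cut k i y - cut k i z <= C * enorm (y - z).
Proof.
have [mem0|memN0] := eqVneq (mem k i) [::].
  by rewrite !component_model_nil // subrr mulr_ge0 ?enorm_ge0.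
have [l lmem ->] := component_model_attained _ _ y memN0.
have /memoryP[_ _ il] := lmem.
have := linearization_le_component_model _ _ z _ lmem.
rewrite (linearization_diff _ _ y z).
have := dotp_le_enorm (g (k - l)%N i) (y - z).
have := ler_wpM2r (enorm_ge0 (y - z)) (g_bound _ _ il); lra.
Qed.

Lemma component_model_ge k i y l : l \in mem k i ->
  f i (x (k - l)%N) - C * enorm (y - x (k - l)%N) <= cut k i y.
Proof.
move=> lmem; have /memoryP[_ _ il] := lmem.
apply: le_trans (linearization_le_component_model _ _ y _ lmem).
rewrite /linearization; have := le_enorm_dotp (g (k - l)%N i) (y - x (k - l)%N).
have := ler_wpM2r (enorm_ge0 (y - x (k - l)%N)) (g_bound _ _ il); lra.
Qed.

End SubgradientCuts.
End CutModel.

Lemma subdiff_lipschitz {R : realType} {n : nat} (X : set 'rV[R]_n)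
    (h : 'rV[R]_n -> R) (C : R) (y z : 'rV[R]_n) :
  (subdiff h y !=set0) -> (forall s, subdiff h y s -> enorm s <= C) ->
  h y - C * enorm (z - y) <= h z.
Proof.
move=> [s hs] sC; have := hs z; have := le_enorm_dotp s (z - y).
have := ler_wpM2r (enorm_ge0 (z - y)) (sC s hs); lra.
Qed.

Lemma enorm_drift {R : realType} {n : nat} (x : nat -> 'rV[R]_n) (eta : R)
    (k l : nat) :
  (forall j, (k <= j)%N -> enorm (x j.+1 - x j) <= eta) ->
  enorm (x (k + l)%N - x k) <= l%:R * eta.
Proof.
move=> xeta; elim: l => [|l IHl].
  by rewrite addn0 subrr mul0r /enorm dotp0 sqrtr0.
rewrite addnS.
have -> : x (k + l).+1 - x k = (x (k + l).+1 - x (k + l)%N) + (x (k + l)%N - x k).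
  by rewrite subrKA.
rewrite (le_trans (enormD _ _)) // -natr1 mulrDl mul1r addrC lerD //.
by rewrite xeta // leq_addr.
Qed.

(** * Step lengths, model error and descent of the iterates *)

Section Convergence.
Context {R : realType} {n m : nat}.
Variables (X : set 'rV[R]_n) (f : 'I_m -> 'rV[R]_n -> R) (C : R).
Variables (W : nat) (t : nat -> R) (I : nat -> {set 'I_m}).
Variables (x : nat -> 'rV[R]_n) (g : nat -> 'I_m -> 'rV[R]_n).
Hypothesis hA : assumptionA X f C.
Hypothesis halg : incremental_cutting_plane X f W t I x g.
Hypothesis hcover : forall (k : nat) (i : 'I_m),
  i \in (\bigcup_(l < W) I (k + l)%N)%SET.

Local Notation mem := (memory W I).
Local Notation cut := (component_model f W I x g).

Lemma iterate_in_domain k : X (x k).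
Proof.
case: k => [|k]; first exact: (initial_point halg).
exact: (next_iterate halg k).1.
Qed.

Lemma chosen_subgradient_bound k i : i \in I k -> enorm (g k i) <= C.
Proof.
move=> ik; apply: (subgradient_bound hA (iterate_in_domain k)).
exact: (subgradient_choice halg ik).
Qed.

Let C_ge0 : 0 <= C := ltW (subgradient_bound_gt0 hA).
Let t_gt0 k : 0 < t k := step_size_gt0 halg k.

Lemma iterate_three_points k y : X y ->
  2 * t k * (\sum_(i < m) cut k i (x k.+1)) + enorm (x k.+1 - x k) ^+ 2
    + enorm (y - x k.+1) ^+ 2
  <= 2 * t k * (\sum_(i < m) cut k i y) + enorm (y - x k) ^+ 2.
Proof.
move=> Xy; have t2_gt0 : 0 < 2 * t k by rewrite mulr_gt0.
rewrite -(ler_pM2l (_ : 0 < (2 * t k)^-1)) ?invr_gt0 //.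
rewrite !mulrDr !mulKf ?gt_eqF //.
apply: (@prox_three_points _ _ X (fun y => \sum_(i < m) cut k i y)) => //.
- exact: (domain_convex hA).
- exact: model_sum_convex.
- by rewrite invr_ge0 ltW.
- exact: (next_iterate halg k).
Qed.

(** With [y = x k] and [d] the step length, the three-point inequality and the Lipschitz bound give
    [2 d^2 <= 2 t_k m C d]; divide by [d] unless it is zero. *)
Lemma step_le k : enorm (x k.+1 - x k) <= m%:R * C * t k.
Proof.
have := iterate_three_points k (x k) (iterate_in_domain k).
rewrite subrr (_ : enorm 0 = 0); last by rewrite /enorm dotp0 sqrtr0.
rewrite expr0n addr0 (enormB (x k)) => step.
have : \sum_(i < m) cut k i (x k) - \sum_(i < m) cut k i (x k.+1)
    <= m%:R * C * enorm (x k.+1 - x k).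
  rewrite -sumrB -mulrA mulr_natl -[m in _ *+ m]card_ord -sumr_const.
  apply: ler_sum => i _; rewrite (enormB (x k.+1)).
  exact: (component_model_lipschitz _ _ _ _ _ _ C_ge0 chosen_subgradient_bound).
move: (enorm_ge0 (x k.+1 - x k)) (t_gt0 k) step.
set d := enorm _; set S1 := \sum_(_ < _) _; set S2 := \sum_(_ < _) _.
rewrite le_eqVlt => /predU1P[<- tk_gt0 _ _|d_gt0 tk_gt0 step lip].
  by rewrite !mulr_ge0 // ltW.
rewrite -(ler_pM2r d_gt0); nra.
Qed.

Lemma memory_neq_nil k i : (W.-1 <= k)%N -> mem k i != [::].
Proof.
(* The covering hypothesis is used on the window of [W] iterations ending at [k]; its [l]-th entry
   has age [W.-1 - l]. *)
move=> Wk; have /bigcupP[l _] := hcover (k - W.-1) i.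
have -> : (k - W.-1 + l = k - (W.-1 - l))%N by have := ltn_ord l; lia.
move=> il; have : (W.-1 - l)%N \in mem k i by apply/memoryP; split => //; lia.
by case: (mem k i).
Qed.

(** Each component loses [C W eta] twice: moving [f i] from [x k] back to a stored point
    [x (k - l)], and following the cut from there to [x k.+1]. *)
Lemma model_sum_ge (eta : R) N k : (N + W <= k)%N ->
  (forall j, (N <= j)%N -> enorm (x j.+1 - x j) <= eta) ->
  objective f (x k) - 2 * m%:R * C * W%:R * eta
    <= \sum_(i < m) cut k i (x k.+1).
Proof.
move=> NWk xeta; have eta_ge0 : 0 <= eta by apply: le_trans (xeta N _); rewrite ?enorm_ge0.
have -> : 2 * m%:R * C * W%:R * eta = \sum_(i < m) 2 * C * W%:R * eta.
  by rewrite sumr_const card_ord -mulr_natl; ring.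
rewrite /objective -sumrB; apply: ler_sum => i _.
have [l lmem] : exists l, l \in mem k i.
  have : mem k i != [::] by apply: memory_neq_nil; lia.
  by case: (mem k i) => // l s _; exists l; exact: mem_head.
have /memoryP[lk lW _] := lmem.
have W_gt0 := memory_size_gt0 halg.
(* From [x (k - l)] to [x k.+1] there are [l + 1 <= W] steps, all of index at least [N] since
   [N + W <= k]. *)
have drift p : (p <= W)%N -> enorm (x (k - l + p)%N - x (k - l)%N) <= W%:R * eta.
  move=> pW; apply: le_trans (ler_wpM2r eta_ge0 (_ : p%:R <= W%:R)).
    by apply: enorm_drift => j lej; apply: xeta; lia.
  by rewrite ler_nat.
have := component_model_ge f _ _ x _ C chosen_subgradient_bound _ _ (x k.+1) _ lmem.
have d0 : enorm (x k - x (k - l)%N) <= W%:R * eta.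
  by rewrite -{1}(subnK lk); apply: drift; lia.
have d1 : enorm (x k.+1 - x (k - l)%N) <= W%:R * eta.
  by rewrite -{1}(subnK lk) -addnS; apply: drift; lia.
have := @subdiff_lipschitz _ _ X (f i) C (x k) (x (k - l)%N)
  (component_subdifferentiable hA i (iterate_in_domain k))
  (fun s => subgradient_bound hA (iterate_in_domain k)).
rewrite (enormB (x (k - l)%N)).
have := ler_wpM2l C_ge0 d0; have := ler_wpM2l C_ge0 d1; lra.
Qed.

(** Of the gap [2 delta], one [delta] pays for the model error; the other remains as the difference
    of the model sums at [x k.+1] and [y] in the three-point inequality. *)
Lemma gap_descent (delta eta : R) N y k : X y -> (N + W <= k)%N ->
  (forall j, (N <= j)%N -> enorm (x j.+1 - x j) <= eta) ->
  2 * m%:R * C * W%:R * eta <= delta ->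
  objective f y + 2 * delta <= objective f (x k) ->
  enorm (y - x k.+1) ^+ 2 <= enorm (y - x k) ^+ 2 - 2 * delta * t k.
Proof.
move=> Xy NWk xeta etale gap.
have cut_y : \sum_(i < m) cut k i y <= objective f y.
  apply: ler_sum => i _; apply: component_model_le.
    exact: (@subgradient_choice _ _ _ _ _ _ _ _ _ _ halg).
  by apply: memory_neq_nil; lia.
have cut_x := model_sum_ge eta N k NWk xeta.
have := iterate_three_points k y Xy.
have := sqr_ge0 (enorm (x k.+1 - x k)); have := t_gt0 k.
set S1 := \sum_(i < m) cut k i y in cut_y *.
set S2 := \sum_(i < m) cut k i (x k.+1) in cut_x *.
have : delta <= S2 - S1 by lra.
nra.
Qed.

Hypothesis t_lim : t @ \oo --> (0 : R).

Lemma steps_eventually_le (eta : R) : 0 < eta ->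
  exists N, forall j, (N <= j)%N -> enorm (x j.+1 - x j) <= eta.
Proof.
move=> eta_gt0; have mC_ge0 : 0 <= m%:R * C by rewrite mulr_ge0.
(* The added 1 keeps the denominator positive when [m = 0]. *)
have e_gt0 : 0 < eta / (m%:R * C + 1) by rewrite divr_gt0 //; lra.
have /cvgr0Pnorm_le/(_ _ e_gt0)[N _ tN] := t_lim.
exists N => j Nj; apply: le_trans (step_le j) _.
have : t j <= eta / (m%:R * C + 1) by rewrite -[t j]gtr0_norm //; exact: tN.
rewrite ler_pdivlMr; last lra.
have := t_gt0 j; nra.
Qed.

Hypothesis t_sum : (\sum_(0 <= k <oo) (t k)%:E)%E = +oo%E.

(** A persistent gap lets the descent inequality telescope, so [2 delta] times any tail sum of the
    [t k] stays below one squared distance, against divergence. *)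
Lemma objective_gap_false (delta : R) N y : X y -> 0 < delta ->
  ~ (forall k, (N <= k)%N -> objective f y + 2 * delta <= objective f (x k)).
Proof.
move=> Xy delta_gt0 gap.
set K := 2 * m%:R * C * W%:R.
have K_ge0 : 0 <= K by rewrite !mulr_ge0.
have eta_gt0 : 0 < delta / (K + 1) by rewrite divr_gt0 //; lra.
have [N1 xeta] := steps_eventually_le _ eta_gt0.
have etale : K * (delta / (K + 1)) <= delta.
  by rewrite mulrA ler_pdivrMr; [nra|lra].
(* Beyond [M] the gap holds and every step within the memory window is already small. *)
set M := (N + (N1 + W))%N.
have telescope p : 2 * delta * (\sum_(M <= k < M + p) t k)
    <= enorm (y - x M) ^+ 2 - enorm (y - x (M + p)%N) ^+ 2.
  elim: p => [|p IHp]; first by rewrite addn0 big_geq // mulr0 subrr.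
  rewrite addnS big_nat_recr ?leq_addr //= mulrDr.
  have Np : (N <= M + p)%N by lia.
  have NWp : (N1 + W <= M + p)%N by lia.
  have := gap_descent delta _ N1 y _ Xy NWp xeta etale (gap _ Np); lra.
set B := \sum_(0 <= k < M) t k + enorm (y - x M) ^+ 2 / (2 * delta).
have bounded p : \sum_(0 <= k < p) t k <= B.
  have t_ge0 a b : 0 <= \sum_(a <= k < b) t k by apply: sumr_ge0 => j _; rewrite ltW.
  have le_tail a b : (a <= b)%N -> \sum_(0 <= k < a) t k <= \sum_(0 <= k < b) t k.
    by move=> ab; rewrite (big_cat_nat (n := a) (p := b)) //= lerDl.
  apply: le_trans (le_tail _ (M + p)%N (leq_addl _ _)) _.
  rewrite (big_cat_nat (n := M)) ?leq_addr //= lerD2l ler_pdivlMr ?mulr_gt0 //.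
  rewrite mulrC; apply: le_trans (telescope p) _.
  by rewrite gerBl sqr_ge0.
have : (\sum_(0 <= k <oo) (t k)%:E <= B%:E)%E.
  apply: lime_le; first by apply: is_cvg_nneseries => k _ _; rewrite lee_fin ltW.
  by apply: nearW => p; rewrite sumEFin lee_fin.
by rewrite t_sum.
Qed.

End Convergence.

(** * Identification of the lower limit with the infimum *)

Theorem proposition2p8 (R : realType) (n m : nat)
  (X : set 'rV[R]_n) (f : 'I_m -> 'rV[R]_n -> R) (C : R)
  (W : nat) (t : nat -> R) (I : nat -> {set 'I_m})
  (x : nat -> 'rV[R]_n) (g : nat -> 'I_m -> 'rV[R]_n)
  (hA : assumptionA X f C)
  (halg : incremental_cutting_plane X f W t I x g)
  (hcover : forall (k : nat) (i : 'I_m),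
     i \in (\bigcup_(l < W) I (k + l)%N)%SET)
  (ht_gt0 : forall k : nat, 0 < t k)
  (ht_noninc : forall k : nat, t k.+1 <= t k)
  (ht_lim : t @ \oo --> (0 : R))
  (ht_sum : (\sum_(0 <= k <oo) (t k)%:E)%E = +oo%E) :
  limn_einf (fun k : nat => (objective f (x k))%:E)
    = ereal_inf [set (objective f z)%:E | z in X].
Proof.
rewrite limn_einf_lim; set u := fun k : nat => _.
apply/eqP; rewrite eq_le; apply/andP; split; last first.
  apply: lime_ge; first exact: is_cvg_einfs.
  apply: nearW => N; apply: le_ereal_inf_tmp => _ [k _ <-].
  by apply: ereal_inf_lbound; exists (x k) => //; exact: iterate_in_domain halg _.
(* If a tail infimum exceeded the infimum over [X], some [y] in [X] would stay strictly below that
   whole tail. No minimizer is required, so an infimum of [-oo] is covered. *)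
apply: lime_le; first exact: is_cvg_einfs.
apply: nearW => N; rewrite leNgt; apply/negP => /ereal_inf_lt[_ [y Xy <-]].
(* The value [+oo] is excluded because the tail infimum is at most the finite [u N]. *)
case einfN : (einfs u N) => [r| |] //; last first.
  have : (einfs u N <= u N)%E by apply: ereal_inf_lbound; exists N => /=.
  by rewrite einfN.
rewrite lte_fin => yr.
have gap_gt0 : 0 < (r - objective f y) / 2 by lra.
apply: (objective_gap_false _ _ _ _ _ _ _ _ hA halg hcover ht_lim ht_sum _ N y
  Xy gap_gt0).
move=> k Nk; have : (einfs u N <= u k)%E by apply: ereal_inf_lbound; exists k => /=.
rewrite einfN lee_fin; lra.
Qed.
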